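(* Let $(X,d)$ be a compact metric space and $f:X\to X$ a continuous map. Then $$\dim_H(X)\cdot h_L^+(f)\ \ge\ h(f).$$
   Context: Lebesgue number: for an open cover $\mathcal{U}$ of $X$, the Lebesgue number $\delta(\mathcal{U})$ is the largest number $\delta>0$ such that every open ball of radius at most $\delta$ is contained in some element of $\mathcal{U}$. If $X\notin\mathcal{U}$, it equals $\min_{x\in X}\delta(\mathcal{U},x)$, where $\delta(\mathcal{U},x)=\sup_{U\in\mathcal{U}}\inf_{y\in X\setminus U}d(x,y)$. Lebesgue numbers are always bounded by the diameter of the space. For open covers, $\mathcal{U}\vee\mathcal{V}=\{U\cap V: U\in\mathcal{U},V\in\mathcal{V}\}$, $f^{-k}(\mathcal{U})=\{f^{-k}(U):U\in\mathcal{U}\}$, $\mathcal{U}_f^n=\bigvee_{k=0}^{n-1}f^{-k}(\mathcal{U})$, and $\delta_n(f,\mathcal{U})=\delta(\mathcal{U}_f^n)$. $h_L^+(f,\mathcal{U})=\limsup_{n\to\infty}-\frac1n\log\delta_n(f,\mathcal{U})$ and $h_L^+(f)=\sup_{\mathcal{U}}h_L^+(f,\mathcal{U})$, the supremum being over all finite open covers of $X$. $\dim_H(X)$ is the (classical) Hausdorff dimension of $X$. $h(f)$ is the topological entropy: $h(f)=\lim_{\epsilon\to0}\limsup_{n\to\infty}\frac1n\log s_n(f,\epsilon)=\lim_{\epsilon\to0}\liminf_{n\to\infty}\frac1n\log s_n(f,\epsilon)$, where $s_n(f,\epsilon)$ is the maximal cardinality of a set $E\subset X$ with $\max_{0\le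 k\le n-1}d(f^k(x),f^k(y))>\epsilon$ for all distinct $x,y\in E$.
   Formalization: The inequality is asserted only when the product dim_H(X)·h_L^+(f) is not of the indeterminate form 0·∞ or ∞·0; with 0·∞ read as 0 it fails, e.g. for a full 2-shift with a super-exponentially small metric. *)

(* Defs.v *)
From HB Require Import structures.
From mathcomp Require Import all_boot all_order all_algebra.
From mathcomp Require Import all_classical all_reals all_analysis.
Import Order.TTheory GRing.Theory Num.Theory.
Import numFieldNormedType.Exports.

Set Implicit Arguments.
Unset Strict Implicit.
Unset Printing Implicit Defensive.

Local Open Scope classical_set_scope.
Local Open Scope ring_scope.

(* Real-valued, so meaningful for bounded sets only (any subset of a compact
   space is bounded); diam set0 = sup set0 = 0. *)
Definition diam (R : realType) (X : metricType R) (A : set X) : R :=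
  sup [set mdist x y | x in A & y in A].

Definition finite_open_cover (R : realType) (X : metricType R)
    (U : set (set X)) : Prop :=
  [/\ finite_set U, U `<=` open & \bigcup_(A in U) A = setT].

Definition cover_join (T : Type) (U V : set (set T)) : set (set T) :=
  [set A `&` B | A in U & B in V].

Definition cover_preimage (T : Type) (g : T -> T) (U : set (set T)) :
    set (set T) :=
  [set g @^-1` A | A in U].

(* The trivial cover [set setT] is neutral for cover_join. *)
Definition cover_iter (T : Type) (f : T -> T) (U : set (set T)) (n : nat) :
    set (set T) :=
  \big[@cover_join T/[set setT]]_(k < n) cover_preimage (iter k f) U.

(* The bound by the diameter is automatic when setT is not in U; when setT is
   in U every radius works and the Lebesgue number is diam setT by convention.
   For a space with at most one point the set below is empty and the value is
   0; as ln 0 = 0, the rates below then vanish. *)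
Definition lebesgue_number (R : realType) (X : metricType R)
    (U : set (set X)) : R :=
  sup [set delta : R | [/\ 0 < delta, delta <= diam [set: X] &
    forall (x : X) (r : R), 0 < r <= delta ->
      exists2 A, U A & ball x r `<=` A]].

Definition lebesgue_rate_cover (R : realType) (X : metricType R)
    (f : X -> X) (U : set (set X)) : \bar R :=
  limn_esup (fun n : nat =>
    (- (n%:R^-1 * ln (lebesgue_number (cover_iter f U n))))%:E).

Definition lebesgue_rate (R : realType) (X : metricType R) (f : X -> X) :
    \bar R :=
  ereal_sup [set lebesgue_rate_cover f U | U in @finite_open_cover R X].

(* diam A ^ s with the usual convention that the empty set contributes 0, also
   for s = 0 (whereas 0 `^ 0 = 1 is what a singleton contributes). *)
Definition diam_pow (R : realType) (X : metricType R) (s : R) (A : set X) : R :=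
  if A == set0 then 0 else diam A `^ s.

Definition hausdorff_premeasure (R : realType) (X : metricType R)
    (s delta : R) (A : set X) : \bar R :=
  ereal_inf [set (\sum_(0 <= i <oo) (diam_pow s (C i))%:E)%E | C in
    [set C : nat -> set X |
      (forall i, diam (C i) <= delta) /\ A `<=` \bigcup_i C i]].

Definition hausdorff_measure (R : realType) (X : metricType R)
    (s : R) (A : set X) : \bar R :=
  lim (hausdorff_premeasure s delta A @[delta --> (0 : R)^'+]).

Definition hausdorff_dim (R : realType) (X : metricType R) (A : set X) :
    \bar R :=
  ereal_inf [set s%:E | s in
    [set s : R | 0 <= s /\ hausdorff_measure s A = 0%E]].

Definition bowen_dist (R : realType) (X : metricType R) (f : X -> X)
    (n : nat) (x y : X) : R :=
  \big[Num.max/0]_(k < n) mdist (iter k f x) (iter k f y).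

(* Real-valued: on a compact space, with f continuous and 0 < eps, the sizes
   are bounded, so that the supremum is the maximum. *)
Definition separated_number (R : realType) (X : metricType R) (f : X -> X)
    (n : nat) (eps : R) : R :=
  sup [set (size E)%:R | E in [set E : seq X | uniq E /\
    forall x y, x \in E -> y \in E -> x != y -> eps < bowen_dist f n x y]].

Definition topological_entropy (R : realType) (X : metricType R)
    (f : X -> X) : \bar R :=
  lim (limn_esup (fun n : nat =>
         (n%:R^-1 * ln (separated_number f n eps))%:E)
       @[eps --> (0 : R)^'+]).

(* Main.v *)
Require Import Defs.
From mathcomp Require Import all_boot all_order all_algebra.
From mathcomp Require Import all_classical all_reals all_analysis.
From mathcomp Require Import lra.
Import Order.TTheory GRing.Theory Num.Theory.

(* Let s > dim_H(X) and b > h_L^+(f).  For large n every ball of radius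
   exp(-bn) lies in an element of the n-th iterated cover, hence has Bowen
   diameter at most eps up to time n.  Since H^s(X) = 0, X is covered by
   finitely many such balls V_i, of radius exp(-b m_i), with
   sum_i exp(-s b m_i) <= 1.  An (n, eps)-separated set splits into its parts
   in the V_i, and f^(m_i) maps the i-th part injectively onto an
   (n - m_i, eps)-separated set; by induction on n its cardinality is at most
   exp(s b (n + max_i m_i)), so that h(f) <= s b. *)

Local Open Scope classical_set_scope.

(** * Bowen distances, separated sets and the counting induction *)

Section BowenBalls.
Local Open Scope ring_scope.
Context {R : realType} {X : metricType R}.
Implicit Types (f : X -> X) (U : set (set X)) (eps : R) (E : seq X).

Definition bowen_separated f n eps E : Prop :=
  uniq E /\ forall x y, x \in E -> y \in E -> x != y -> eps < bowen_dist f n x y.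

Lemma bowen_dist_gtP f n eps x y : 0 <= eps ->
  reflect (exists2 k, (k < n)%N & eps < mdist (iter k f x) (iter k f y))
    (eps < bowen_dist f n x y).
Proof.
move=> eps0; apply: (iffP (bigmax_gtP _ _ _ _)).
  by case=> [|[k _ kP]]; [rewrite ltNge eps0|exists k].
by case=> k kn kP; right; exists (Ordinal kn).
Qed.

Lemma bowen_dist_le f n m x y : (n <= m)%N ->
  bowen_dist f n x y <= bowen_dist f m x y.
Proof.
move=> nm.
exact: (le_bigmax_ord predT (fun k => mdist (iter k f x) (iter k f y)) nm).
Qed.

Lemma le_mdist_bowen f n k x y : (k < n)%N ->
  mdist (iter k f x) (iter k f y) <= bowen_dist f n x y.
Proof.
move=> kn; pose F (k : 'I_n) := mdist (iter k f x) (iter k f y).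
exact: (le_bigmax _ F (Ordinal kn)).
Qed.

(** A time [k < n] at which the orbits are more than [eps] apart cannot lie before [m], so it is
    still visible as time [k - m] after the shift. *)
Lemma bowen_dist_shift f m n eps x y : 0 <= eps ->
  bowen_dist f m x y <= eps -> eps < bowen_dist f n x y ->
  eps < bowen_dist f (n - m) (iter m f x) (iter m f y).
Proof.
move=> eps0 xym /bowen_dist_gtP => /(_ eps0) [k kn kP].
have mk : (m <= k)%N.
  rewrite leqNgt; apply/negP => km.
  by have := le_trans (le_mdist_bowen f m k x y km) xym; rewrite leNgt kP.
apply/bowen_dist_gtP => //; exists (k - m)%N.
  by rewrite ltn_sub2r// (leq_ltn_trans mk).
by rewrite -!iterD subnK.
Qed.

Lemma size_le_sum_count (T : choiceType) (N : nat) (V : nat -> set T) (E : seq T) :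
  (forall x, exists2 i, (i < N)%N & V i x) ->
  (size E <= \sum_(i < N) count (fun x => x \in V i) E)%N.
Proof.
move=> covV; elim: E => [//|x E IH].
rewrite [leqLHS]/= -add1n [leqRHS]big_split/= leq_add//.
have [i iN Vix] := covV x.
by rewrite (bigD1 (Ordinal iN))//= mem_set.
Qed.

Lemma separated_filter f n eps E (P : pred X) :
  bowen_separated f n eps E -> bowen_separated f n eps [seq x <- E | P x].
Proof.
move=> [uE sE]; split; first exact: filter_uniq.
by move=> x y; rewrite !mem_filter => /andP[_ xE] /andP[_ yE]; exact: sE.
Qed.

Lemma separated_size_le1 f n eps E : bowen_separated f n eps E ->
  (forall x y, x \in E -> y \in E -> bowen_dist f n x y <= eps) ->
  (size E <= 1)%N.
Proof.
case: E => [//|x [//|y E]] [/= uE sE] dE.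
have xy : x != y by move: uE; rewrite inE negb_or => /andP[/andP[]].
have := sE x y; have := dE x y; rewrite !inE !eqxx orbT.
move=> /(_ isT isT) + /(_ isT isT xy).
by rewrite leNgt => /negP.
Qed.

(** Injectivity of [iter m f] on [E] comes from the shift as well: two points with the same image
    would have orbits at distance 0 from time [m] on, and at most [eps] before. *)
Lemma separated_map_iter f m n eps E : 0 <= eps ->
  (forall x y, x \in E -> y \in E -> bowen_dist f m x y <= eps) ->
  bowen_separated f n eps E -> bowen_separated f (n - m) eps (map (iter m f) E).
Proof.
move=> eps0 dE [uE sE]; split.
  rewrite map_inj_in_uniq// => x y xE yE fxy; apply/eqP/negP => /negP xy.
  have /bowen_dist_gtP := bowen_dist_shift f m n _ _ _ eps0
    (dE _ _ xE yE) (sE _ _ xE yE xy).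
  by move=> /(_ eps0)[k _]; rewrite fxy mdistxx ltNge eps0.
move=> _ _ /mapP[x xE ->] /mapP[y yE ->] fxy.
apply: bowen_dist_shift => //; first exact: dE.
by apply: sE => //; apply: contraNneq fxy => ->.
Qed.

(** Strong induction on [n]: the points of [E] in [V i] number at most the claimed bound times
    [expR (- (lam * m i))], and these weights sum to at most 1. The constant [M] absorbs the times
    [n] that are too short for a further shift. *)
Lemma separated_size_le f eps (N : nat) (V : nat -> set X) (m : nat -> nat)
    (M : nat) (lam : R) :
  0 <= eps -> 0 <= lam ->
  (forall x, exists2 i, (i < N)%N & V i x) ->
  (forall i, (0 < m i)%N) -> (forall i, (i < N)%N -> (m i <= M)%N) ->
  (forall i x y, V i x -> V i y -> bowen_dist f (m i) x y <= eps) ->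
  \sum_(i < N) expR (- (lam * (m i)%:R)) <= 1 ->
  forall n E, bowen_separated f n eps E -> (size E)%:R <= expR (lam * (n + M)%:R).
Proof.
move=> eps0 lam0 covV m0 mM dV sum1 n; elim/ltn_ind: n => n IH E sE.
have sizeV (i : 'I_N) : (count (fun x => x \in V i) E)%:R <=
    expR (lam * (n + M)%:R) * expR (- (lam * (m i)%:R)).
  rewrite -expRD -mulrBr -natrB ?(leq_trans (mM _ (ltn_ord i))) ?leq_addl//.
  rewrite -size_filter; set Ei := seq.filter _ E.
  have sEi : bowen_separated f n eps Ei by exact: separated_filter.
  have dEi x y : x \in Ei -> y \in Ei -> bowen_dist f (m i) x y <= eps.
    rewrite !mem_filter => /andP[/set_mem Vx _] /andP[/set_mem Vy _].
    exact: dV.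
  (* For [n <= m i] the part has at most one point, and the bound is at least 1 because [m i <= M].
     Otherwise the image under [iter (m i) f] is separated up to the smaller time [n - m i]. *)
  have [nm|mn] := leqP n (m i).
    apply: (@le_trans _ _ 1%:R); last by rewrite -expR0 ler_expR mulr_ge0.
    rewrite (ler_nat _ _ 1); apply: (separated_size_le1 f n eps) => // x y xE yE.
    exact: le_trans (bowen_dist_le f _ _ x y nm) (dEi _ _ xE yE).
  rewrite -addnBAC ?(ltnW mn)// -(size_map (iter (m i) f)).
  apply: IH; first by rewrite ltn_subrL m0 (leq_ltn_trans _ mn).
  exact: separated_map_iter.
have := size_le_sum_count _ N V E covV; rewrite -(ler_nat R) => /le_trans; apply.
rewrite natr_sum; apply: le_trans (ler_sum _ (fun i _ => sizeV i)) _.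
by rewrite -mulr_sumr ler_piMr// expR_ge0.
Qed.

End BowenBalls.

(** * Consequences of compactness: finite subcovers, bounded distances, Lebesgue radii *)

Lemma metric_ball_open (R : realType) (X : metricType R) (x : X) (r : R) :
  open (ball x r).
Proof.
rewrite openE => y; rewrite ballEmdist/= => xy.
apply/nbhs_ballP; exists (r - mdist x y)%R => [|z]; first by rewrite /= subr_gt0.
rewrite !ballEmdist/= ltrBrDl; exact: le_lt_trans (metric_triangle x y z).
Qed.

Section CompactCovers.
Local Open Scope ring_scope.
Context {R : realType} {X : metricType R}.
Context (cptX : compact [set: X]).
Implicit Types (f : X -> X) (U : set (set X)).

(** Near-covering compactness along the filter [\oo]: near a point of [V i], every [N > i] works. *)
Lemma compact_nat_subcover (V : nat -> set X) :
  (forall i, open (V i)) -> (forall x, exists i, V i x) ->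
  exists N, forall x, exists2 i, (i < N)%N & V i x.
Proof.
move=> oV cV.
have /(_ nat \oo (fun N x => exists2 i, (i < N)%N & V i x)) :=
  (compact_near_coveringP _).1 cptX.
case=> [x _|N _ /(_ N (leqnn N)) NV]; last first.
  by exists N => x; exact: NV.
have [i Vix] := cV x.
exists (V i, [set n | (i < n)%N]) => /=.
  split; last exact: nbhs_infty_gt.
  by apply: open_nbhs_nbhs; split.
by case=> y n /= [Viy ni]; exists i.
Qed.

(** Near-covering compactness again, now along the filter of finite sequences directed by inclusion;
    near [x], every sequence containing [x] works. *)
Lemma compact_finite_ball_cover (r : R) : 0 < r ->
  exists s : seq X, forall x, exists2 y, y \in s & ball y r x.
Proof.
move=> r0.
pose G := filter_from [set: seq X] (fun s => [set s' : seq X | {subset s <= s'}]).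
have FG : Filter G.
  apply: filter_fromT_filter; first by exists [::].
  move=> s t; exists (s ++ t) => u /= stu.
  by split=> y yst; apply: stu; rewrite mem_cat yst ?orbT.
have /(_ _ G (fun s x => exists2 y, y \in s & ball y r x) FG) :=
  (compact_near_coveringP _).1 cptX.
case=> [x _|s _ /(_ s) sV]; last first.
  by exists s => x; apply: sV => //= y.
exists (ball x r, [set s : seq X | x \in s]) => /=.
  split; first exact: nbhsx_ballx.
  by exists [:: x] => // s /= -> //; rewrite inE.
by case=> y s /= [xy xs]; exists x.
Qed.

Lemma compact_bounded_mdist (x : X) : exists r, forall y, mdist x y <= r.
Proof.
have [s sX] := compact_finite_ball_cover 1 ltr01.
exists (\sum_(y <- s) mdist x y + 1) => y.
have [z zs] := sX y; rewrite ballEmdist/= => zy.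
apply: le_trans (metric_triangle x z y) _; apply: lerD (ltW zy).
by rewrite (big_rem z)//= lerDl sumr_ge0// => *; exact: mdist_ge0.
Qed.

Lemma has_ubound_mdist (A : set X) : has_ubound [set mdist x y | x in A & y in A].
Proof.
have [[x0 Ax0]|A0] := pselect (exists x, A x); last first.
  by exists 0 => z [x Ax _]; case: A0; exists x.
have [r x0r] := compact_bounded_mdist x0.
exists (r + r) => _ [x Ax [y Ay <-]].
by rewrite (le_trans (metric_triangle x x0 y))// lerD// metric_sym.
Qed.

Lemma mdist_le_diam (A : set X) x y : A x -> A y -> mdist x y <= diam A.
Proof.
move=> Ax Ay; apply: ub_le_sup; first exact: has_ubound_mdist.
by exists x => //; exists y.
Qed.

Lemma diam_ge0 (A : set X) : 0 <= diam A.
Proof.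
have [->|/set0P[x Ax]] := eqVneq A set0; last first.
  by rewrite -(mdistxx x); exact: mdist_le_diam.
rewrite /diam (_ : [set _ | _ in _ & _ in _] = set0) ?sup0//.
by rewrite -subset0 => z [].
Qed.

(** Here the near-covering filter is that of small positive radii. If the ball of radius [e] about
    [x] lies in [A], halving [e] leaves room for balls about all points near [x]. *)
Lemma compact_lebesgue_number U : U `<=` open -> \bigcup_(A in U) A = setT ->
  exists2 r : R, 0 < r & forall x, exists2 A, U A & ball x r `<=` A.
Proof.
move=> oU cU.
have /(_ _ 0^'+ (fun (r : R) x => exists2 A, U A & ball x r `<=` A)) :=
  (compact_near_coveringP _).1 cptX.
case=> [x _|e /= e0 eU]; last first.
  exists (e / 2); first by rewrite divr_gt0.
  move=> x; apply: eU => //=; last by rewrite divr_gt0.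
  by rewrite sub0r normrN gtr0_norm ?divr_gt0// ltr_pdivrMr// ltr_pMr// ltr1n.
have [A UA Ax] : (\bigcup_(A in U) A) x by rewrite cU.
have /nbhs_ballP[e /= e0 eA] : nbhs x A by apply: open_nbhs_nbhs; split; [exact: oU|].
exists (ball x (e / 2), [set r | r < e / 2]) => /=.
  split; first by apply: nbhsx_ballx; rewrite divr_gt0.
  by apply: nbhs_right_lt; rewrite divr_gt0.
case=> y r /= [xy re]; exists A => // z yz; apply: eA.
by apply: (@ball_split _ _ y) => //; apply: le_ball yz; exact: ltW.
Qed.

End CompactCovers.

(** * Iterated covers *)

Section CoverIter.
Context {T : Type}.

Lemma sub_cover_join_big (n : nat) (W : nat -> set (set T)) (A : set T) :
  (\big[@cover_join T/[set setT]]_(k < n) W k) A ->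
  forall k, (k < n)%N -> exists2 B, W k B & A `<=` B.
Proof.
elim: n W A => [//|n IH] W A; rewrite big_ord_recl => -[B WB [C WC <-]] [_|k kn].
  by exists B => // x [].
have [D WD CD] := IH (fun k => W k.+1) C WC k kn.
by exists D => // x [_ /CD].
Qed.

(** This converts small diameters of the elements of [U] into small Bowen diameters of the elements
    of [cover_iter f U n]. *)
Lemma cover_iter_sub (f : T -> T) U n A k : cover_iter f U n A -> (k < n)%N ->
  exists2 B, U B & A `<=` iter k f @^-1` B.
Proof.
move=> UA kn.
have [_ [B UB <-] AB] :=
  sub_cover_join_big n (fun k => cover_preimage (iter k f) U) A UA k kn.
by exists B.
Qed.

Lemma cover_iter_cover (f : T -> T) U n : \bigcup_(A in U) A = setT ->
  \bigcup_(A in cover_iter f U n) A = setT.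
Proof.
move=> cU; apply: (big_ind (fun W => \bigcup_(A in W) A = setT)).
- by rewrite bigcup_set1.
- move=> V W cV cW; rewrite -subTset => x _.
  have [A VA Ax] : (\bigcup_(A in V) A) x by rewrite cV.
  have [B WB Bx] : (\bigcup_(A in W) A) x by rewrite cW.
  by exists (A `&` B) => //; exists A => //; exists B.
- move=> k _; rewrite -subTset => x _.
  have [A UA Ax] : (\bigcup_(A in U) A) (iter k f x) by rewrite cU.
  by exists (iter k f @^-1` A) => //; exists A.
Qed.

End CoverIter.

Lemma continuous_iter (T : topologicalType) (f : T -> T) k :
  continuous f -> continuous (iter k f).
Proof.
move=> cf; elim: k => [|k IH] x; first exact: cvg_id.
by apply: (continuous_comp (IH x)); exact: cf.
Qed.

Lemma cover_iter_open (T : topologicalType) (f : T -> T) (U : set (set T)) n :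
  continuous f -> U `<=` open -> cover_iter f U n `<=` open.
Proof.
move=> cf oU; apply: (big_ind (fun W => W `<=` open)).
- by move=> _ ->; exact: openT.
- by move=> V W oV oW _ [A /oV oA [B /oW oB <-]]; exact: openI.
- move=> k _ _ [A /oU oA <-]; apply: open_comp => // x _.
  exact: continuous_iter.
Qed.

(** * Upper limits of extended real sequences *)

Section LimnEsup.
Context {R : realType}.
Local Open Scope ereal_scope.
Implicit Types u v : (\bar R)^nat.

Lemma limn_esup_lt_near u (l : \bar R) : limn_esup u < l ->
  \forall n \near \oo, u n < l.
Proof.
move=> /ereal_inf_lt[_ [V Voo <-] Vl].
apply: filterS Voo => n Vn; apply: le_lt_trans Vl.
by apply: ereal_sup_ubound; exists n.
Qed.

Lemma le_limn_esup u v : (forall n, u n <= v n) -> limn_esup u <= limn_esup v.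
Proof.
move=> uv; apply: le_ereal_inf_tmp => _ [V Voo <-].
apply: (@le_trans _ _ (ereal_sup (u @` V))).
  by apply: ereal_inf_lbound; exists V.
apply: ge_ereal_sup => _ [n Vn <-]; apply: le_trans (uv n) _.
by apply: ereal_sup_ubound; exists n.
Qed.

Lemma limn_esup_le_near u (l : \bar R) :
  (forall e : R, (0 < e)%R -> \forall n \near \oo, u n <= l + e%:E) ->
  limn_esup u <= l.
Proof.
move=> ul; apply/lee_addgt0Pr => e e0.
apply: (@le_trans _ _ (ereal_sup (u @` [set n | u n <= l + e%:E]))).
  by apply: ereal_inf_lbound; exists [set n | u n <= l + e%:E] => //; exact: ul.
by apply: ge_ereal_sup => _ [n Vn <-].
Qed.

Lemma limn_esup_ge_near u (l : \bar R) :
  (forall e : R, (0 < e)%R -> \forall n \near \oo, l <= u n + e%:E) ->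
  l <= limn_esup u.
Proof.
move=> ul; apply: le_ereal_inf_tmp => _ [V Voo <-]; apply/lee_addgt0Pr => e e0.
have [n [Vn lun]] := @filter_ex _ _ _ _ (filterI Voo (ul e e0)).
by apply: le_trans lun _; apply: leeD2r; apply: ereal_sup_ubound; exists n.
Qed.

Lemma near_normr_invnM_le (c e : R) : (0 < e)%R ->
  \forall n \near \oo, (`|n%:R^-1 * c| <= e)%R.
Proof.
move=> e0; near=> n.
have n0 : (0 < n%:R :> R)%R by rewrite ltr0n; near: n; exact: nbhs_infty_gt.
rewrite normrM gtr0_norm ?invr_gt0// ler_pdivrMl// -ler_pdivrMr//.
by near: n; apply: filterS (nbhs_infty_gtr (`|c| / e)) => m /ltW.
Unshelve. all: by end_near. Qed.

End LimnEsup.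

(** * Lebesgue numbers and their exponential rate *)

Section LebesgueRate.
Local Open Scope ring_scope.
Context {R : realType} {X : metricType R}.
Context (cptX : compact [set: X]).
Context (f : X -> X).

Lemma lebesgue_number_gt0 (U : set (set X)) : 0 < diam [set: X] ->
  U `<=` open -> \bigcup_(A in U) A = setT -> 0 < lebesgue_number U.
Proof.
move=> dX oU cU; have [r r0 rU] := compact_lebesgue_number cptX U oU cU.
have m0 : 0 < Num.min r (diam [set: X]) by rewrite lt_min r0.
apply: (lt_le_trans m0); apply: ub_le_sup; first by exists (diam [set: X]) => d [].
split=> //; first by rewrite ge_min lexx orbT.
move=> x d /andP[d0]; rewrite le_min => /andP[dr _].
have [A UA rA] := rU x; exists A => //.
by apply: subset_trans rA; exact: le_ball.
Qed.

Lemma ball_sub_of_lt_lebesgue_number (U : set (set X)) (r : R) : 0 < r ->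
  r < lebesgue_number U -> forall x, exists2 A, U A & ball x r `<=` A.
Proof.
move=> r0; rewrite /lebesgue_number; set S := (S in sup S) => rS x.
(* The supremum of an empty set is 0, which would contradict [0 < r < sup S]. *)
have S0 : S !=set0.
  apply/set0P/eqP => S0; move: rS; rewrite S0 sup0.
  by rewrite ltNge (ltW r0).
have [d [d0 _ dU] rd] := sup_gt S0 rS.
by apply: dU; rewrite r0 ltW.
Qed.

(** A rate below [b] means that the [n]-th Lebesgue number eventually exceeds [expR (- (b * n))].
    Undoing the logarithm requires this number to be positive, hence a space of positive
    diameter. *)
Lemma ball_sub_cover_iter (U : set (set X)) (b : R) : continuous f ->
  0 < diam [set: X] -> U `<=` open -> \bigcup_(A in U) A = setT ->
  (lebesgue_rate_cover f U < b%:E)%E ->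
  \forall n \near \oo, forall x,
    exists2 A, cover_iter f U n A & ball x (expR (- (b * n%:R))) `<=` A.
Proof.
move=> cf dX oU cU /limn_esup_lt_near Ub.
apply: filterS2 Ub (nbhs_infty_gt 0) => n; rewrite lte_fin => nb n0.
apply: ball_sub_of_lt_lebesgue_number; first exact: expR_gt0.
have L0 : 0 < lebesgue_number (cover_iter f U n).
  apply: lebesgue_number_gt0 => //; first exact: cover_iter_open.
  exact: cover_iter_cover.
rewrite -[ltRHS]lnK ?posrE// ltr_expR ltrNl.
by move: nb; rewrite -mulrN ltr_pdivrMl ?ltr0n// mulrC.
Qed.

Lemma cover_iter_trivial (T : Type) (g : T -> T) n :
  cover_iter g [set [set: T]] n = [set [set: T]].
Proof.
apply: (big_ind (fun W => W = [set [set: T]])) => //.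
- move=> V W -> ->; apply/seteqP; split=> A.
    by move=> [_ -> [_ -> <-]]; rewrite setTI.
  by move=> ->; exists setT => //; exists setT => //; rewrite setTI.
- by move=> k _; rewrite /cover_preimage image_set1 preimage_setT.
Qed.

(** The trivial cover is fixed by iteration, so its Lebesgue numbers are constant in [n] and its
    rate is at least 0. *)
Lemma lebesgue_rate_ge0 : (0 <= lebesgue_rate f)%E.
Proof.
apply: (@le_trans _ _ (lebesgue_rate_cover f [set [set: X]])); last first.
  apply: ereal_sup_ubound; exists [set [set: X]] => //; split.
  - exact: finite_set1.
  - by move=> _ ->; exact: openT.
  - by rewrite bigcup_set1.
apply: limn_esup_ge_near => e e0.
apply: filterS (near_normr_invnM_le (ln (@lebesgue_number R X [set setT])) e e0).
move=> n; rewrite cover_iter_trivial -EFinD lee_fin ler_norml => /andP[_ h].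
by rewrite addrC subr_ge0.
Qed.

Lemma lebesgue_rate_cover_le (U : set (set X)) : finite_open_cover U ->
  (lebesgue_rate_cover f U <= lebesgue_rate f)%E.
Proof. by move=> fU; apply: ereal_sup_ubound; exists U. Qed.

End LebesgueRate.

(** * From covers of small Hausdorff sum to a bound on separated sets *)

Section HausdorffCovers.
Local Open Scope ring_scope.
Context {R : realType} {X : metricType R}.
Context (cptX : compact [set: X]).

(** The premeasure grows as [delta] decreases, so its limit at 0 from the right is a supremum. *)
Lemma hausdorff_premeasure_le_measure (s delta : R) (A : set X) : 0 < delta ->
  (hausdorff_premeasure s delta A <= hausdorff_measure s A)%E.
Proof.
move=> delta0; rewrite /hausdorff_measure.
have anti : {in `]0, +oo[%R &, {homo (fun d => hausdorff_premeasure s d A) :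
    d d' / d <= d' >-> (d' <= d)%E}}.
  move=> d d' _ _ dd'; apply: ereal_inf_le_tmp => _ [C [Cd AC] <-].
  by exists C => //; split=> // i; exact: le_trans (Cd i) dd'.
rewrite (cvg_lim _ (nonincreasing_at_right_cvge +oo%O _ anti))//.
by apply: ereal_sup_ubound; exists delta => //=; rewrite in_itv/= delta0.
Qed.

Lemma diam_pow_ge0 (s : R) (A : set X) : 0 <= diam_pow s A.
Proof. by rewrite /diam_pow; case: ifP => // _; exact: powR_ge0. Qed.

(** For diameter 0 the strict inequality matters: it makes [t] positive, so that a singleton
    contributes 0 to the left side even when [s = 0]. *)
Lemma le_diam_pow (s t : R) (A : set X) : 0 <= s -> s < t -> diam A <= 1 ->
  diam_pow t A <= diam_pow s A.
Proof.
move=> s0 st A1; rewrite /diam_pow; case: ifP => // _.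
have := diam_ge0 cptX A; rewrite le_eqVlt => /predU1P[<-|A0].
  by rewrite powR0 ?powR_ge0// gt_eqF// (le_lt_trans s0).
by apply: ger_powR; rewrite ?A0// ltW.
Qed.

Lemma hausdorff_null_cover (s t eta : R) : 0 <= s -> s < t ->
  hausdorff_measure s [set: X] = 0%E -> 0 < eta ->
  exists2 C : nat -> set X, \bigcup_i C i = setT &
    (\sum_(0 <= i <oo) (diam_pow t (C i))%:E < eta%:E)%E.
Proof.
move=> s0 st Hs eta0.
have : (hausdorff_premeasure s 1 [set: X] < eta%:E)%E.
  apply: le_lt_trans (hausdorff_premeasure_le_measure s 1 _ ltr01) _.
  by rewrite Hs lte_fin.
move=> /ereal_inf_lt[_ [C [C1 CX] <-] Ceta].
exists C; first by rewrite -subTset.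
apply: le_lt_trans Ceta; apply: lee_nneseries => i *.
  by rewrite lee_fin diam_pow_ge0.
by rewrite lee_fin le_diam_pow.
Qed.

(** With [m] the integer part of [- ln p / lam], rounding [p] up to a power of [expR (- lam)] costs
    a factor of at most [expR lam]. *)
Lemma exp_bracket (lam p : R) (K : nat) : 0 < lam -> 0 < p ->
  p <= expR (- (lam * K%:R)) -> exists m, [/\ (K <= m)%N,
    p <= expR (- (lam * m%:R)) & expR (- (lam * m%:R)) <= expR lam * p].
Proof.
move=> lam0 p0 pK.
have lamK : lam * K%:R <= - ln p.
  by rewrite lerNr -ler_expR lnK ?posrE.
have Kt : K%:R <= - ln p / lam by rewrite ler_pdivlMr// mulrC.
have /truncn_itv/andP[] := le_trans (ler0n R K) Kt.
set m := Num.truncn _; rewrite ler_pdivlMr// ltr_pdivrMr// => mp pm.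
exists m; split.
- rewrite -ltnS -(ltr_nat R); apply: le_lt_trans Kt _.
  by rewrite ltr_pdivrMr.
- by rewrite -[leLHS]lnK ?posrE// ler_expR lerNr mulrC.
- have -> : expR lam * p = expR (lam + ln p) by rewrite expRD lnK ?posrE.
  rewrite ler_expR.
  move: pm; rewrite -natr1 mulrDl mul1r => pm.
  by rewrite mulrC; lra.
Qed.

Lemma diam_pow_sub_ball (s r : R) (A : set X) x : 0 < s -> 0 < r ->
  diam_pow s A < r `^ s -> A x -> A `<=` ball x r.
Proof.
move=> s0 r0 + Ax y Ay; rewrite ballEmdist/= /diam_pow ifF; last first.
  by apply/negP => /eqP A0; rewrite A0 in Ax.
move=> Ar; apply: le_lt_trans (mdist_le_diam cptX A x y Ax Ay) _.
rewrite ltNge; apply/negP => rA; move: Ar; apply/negP; rewrite -leNgt.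
by apply: ge0_ler_powR => //; rewrite ?nnegrE ?diam_ge0// ltW.
Qed.

Lemma separated_size_bound (f : X -> X) (s b eps : R) :
  continuous f -> 0 < s -> 0 < b -> 0 < eps ->
  (lebesgue_rate f < b%:E)%E ->
  (forall eta : R, 0 < eta ->
    exists2 C : nat -> set X, \bigcup_i C i = setT &
    (\sum_(0 <= i <oo) (diam_pow s (C i))%:E < eta%:E)%E) ->
  exists M, forall n E, bowen_separated f n eps E ->
    (size E)%:R <= expR (s * b * (n + M)%:R).
Proof.
move=> cf s0 b0 eps0 fb smallC; have lam0 : 0 < s * b by rewrite mulr_gt0.
set lam := s * b in lam0 *.
(* In diameter 0 the Lebesgue numbers carry no information, but separated sets have at most one
   point. *)
have := diam_ge0 cptX setT; rewrite le_eqVlt => /predU1P[dX|dX].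
  exists 0%N => n E sE; apply: (@le_trans _ _ 1%:R).
    rewrite (ler_nat _ _ 1); apply: (separated_size_le1 f n eps) => // x y _ _.
    apply: bigmax_le => [|k _]; first exact: ltW.
    by apply: le_trans (mdist_le_diam cptX setT _ _ I I) _; rewrite -dX ltW.
  by rewrite -expR0 ler_expR mulr_ge0// ltW.
have eps2 : 0 < eps / 2 by rewrite divr_gt0.
have [F FX] := compact_finite_ball_cover cptX (eps / 2) eps2.
pose U := [set ball y (eps / 2) | y in [set` F]].
have Ubowen n A x y : cover_iter f U n A -> A x -> A y -> bowen_dist f n x y <= eps.
  move=> UA Ax Ay; apply: bigmax_le => [|k _]; first exact: ltW.
  have [_ [z _ <-] AB] := cover_iter_sub f U n A k UA (ltn_ord k).
  have := AB x Ax; have := AB y Ay; rewrite /preimage/= !ballEmdist/= => zy zx.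
  apply: le_trans (metric_triangle _ z _) _; rewrite metric_sym (splitr eps).
  by rewrite ltW// ltrD.
have fU : finite_open_cover U.
  split; first exact: finite_image.
    by move=> _ [y _ <-]; exact: metric_ball_open.
  rewrite -subTset => x _; have [y yF xy] := FX x.
  by exists (ball y (eps / 2)) => //; exists y.
have [_ oU cU] := fU.
have [K _ KU] := ball_sub_cover_iter cptX f U b cf dX oU cU
  (le_lt_trans (lebesgue_rate_cover_le f U fU) fb).
(* Half of the budget [expR (- (lam * K.+1))] is for the Hausdorff sum, the other half for the terms
   [eta / 2 ^ i.+1], which make every [p i] positive and strictly larger than [diam_pow s (C i)]. *)
pose eta := expR (- (lam * K.+1%:R)) / 2.
have eta0 : 0 < eta by rewrite divr_gt0// expR_gt0.
have [C CX Ceta] := smallC eta eta0.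
pose p i := diam_pow s (C i) + eta / (2 ^ i.+1)%:R.
have p_gt i : diam_pow s (C i) < p i.
  by rewrite ltrDl divr_gt0// ltr0n expn_gt0.
have p0 i : 0 < p i by apply: le_lt_trans (p_gt i); exact: diam_pow_ge0.
have sump N : \sum_(i < N) p i <= expR (- (lam * K.+1%:R)).
  have sump' : (\sum_(0 <= i <oo) (p i)%:E <= (eta + eta)%:E)%E.
    rewrite (eq_eseriesr (fun i _ => EFinD _ _)) EFinD.
    apply: le_trans (epsilon_trick _ _ (ltW eta0)) _.
      by move=> i; rewrite lee_fin diam_pow_ge0.
    by rewrite leeD2r// ltW.
  rewrite -lee_fin; apply: (@le_trans _ _ (eta + eta)%:E); last first.
    by rewrite lee_fin -splitr.
  apply: le_trans sump'; rewrite -sumEFin.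
  rewrite -(big_mkord xpredT (fun i => (p i)%:E)).
  by apply: nneseries_lim_ge => i _ _; rewrite lee_fin ltW.
(* This forces every rounded time to exceed [K], where the ball inclusion [KU] is available. *)
have pK i : p i <= expR (- (lam * K.+1%:R)).
  apply: le_trans (sump i.+1); rewrite big_ord_recr/= lerDr.
  by apply: sumr_ge0 => j _; exact: ltW.
(* With [m] obtained by rounding [p i], the [s]-th power of the diameter of [C i] is below that of
   [expR (- (b * m))], so a ball of this radius about any point of [C i] contains [C i]. *)
have /choice[mV mVP] i : exists mV : nat * set X,
    [/\ open mV.2, C i `<=` mV.2, (K < mV.1)%N,
      expR (- (lam * mV.1%:R)) <= expR lam * p i &
      forall x y, mV.2 x -> mV.2 y -> bowen_dist f mV.1 x y <= eps].
  have [m [Km pm mp]] := exp_bracket lam (p i) K.+1 lam0 (p0 i) (pK i).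
  have [C0|/set0P[x Cx]] := eqVneq (C i) set0.
    by exists (m, set0); split=> //=; [exact: open0|rewrite C0].
  exists (m, ball x (expR (- (b * m%:R)))); split=> //=.
  - exact: metric_ball_open.
  - apply: (diam_pow_sub_ball s _ _ x s0 (expR_gt0 _) _ Cx).
    apply: lt_le_trans (p_gt i) _; rewrite -expRM.
    by rewrite mulNr mulrAC [b * s]mulrC.
  - have [A UA xA] := KU m (ltnW Km) x.
    by move=> y z /xA Ay /xA; exact: Ubowen UA Ay.
have [N NX] : exists N, forall x, exists2 i, (i < N)%N & (mV i).2 x.
  apply: (compact_nat_subcover cptX) => [i|x]; first by case: (mVP i).
  have [i _ Cix] : (\bigcup_i C i) x by rewrite CX.
  by exists i; case: (mVP i) => _ + _ _ _; exact.
exists (\sum_(i < N) (mV i).1)%N => n E.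
apply: (separated_size_le f eps N (fun i => (mV i).2) (fun i => (mV i).1)) => //.
- exact: ltW.
- exact: ltW.
- by move=> i; case: (mVP i) => _ _ + _ _; exact: leq_ltn_trans.
- by move=> i iN; rewrite (bigD1 (Ordinal iN))//= leq_addr.
- by move=> i; case: (mVP i).
- apply: (@le_trans _ _ (\sum_(i < N) expR lam * p i)).
    by apply: ler_sum => i _; case: (mVP i).
  (* The factor [expR lam] lost in rounding is paid for by the successor in [K.+1]. *)
  rewrite -mulr_sumr; apply: le_trans (ler_wpM2l (expR_ge0 _) (sump N)) _.
  rewrite -expRD -expR0 ler_expR -{1}[lam]mulr1 -mulrBr.
  by rewrite mulr_ge0_le0 ?(ltW lam0)// subr_le0 ler1n.
Qed.

End HausdorffCovers.

(** * From the bound on separated sets to topological entropy *)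

Section Entropy.
Local Open Scope ring_scope.
Context {R : realType} {X : metricType R}.
Context (f : X -> X) (lam : R).
Context (lam0 : 0 <= lam).
Context (separated_bound : forall eps : R, 0 < eps ->
  exists M, forall n E, bowen_separated f n eps E ->
    (size E)%:R <= expR (lam * (n + M)%:R)).

Lemma has_sup_separated n (eps : R) : 0 < eps ->
  has_sup [set ((size E)%:R : R) | E in bowen_separated f n eps].
Proof.
move=> /separated_bound[M EM]; split; first by exists 0; exists [::].
by exists (expR (lam * (n + M)%:R)) => _ [E /EM + <-].
Qed.

Lemma separated_number_anti n (eps eps' : R) : 0 < eps -> eps <= eps' ->
  separated_number f n eps' <= separated_number f n eps.
Proof.
move=> eps0 le_eps; apply: ge_sup; first by exists 0; exists [::].
move=> _ [E [uE sE] <-]; apply: ub_le_sup.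
  by have [] := has_sup_separated n eps eps0.
exists E => //; split=> // x y xE yE xy.
exact: le_lt_trans le_eps (sE _ _ xE yE xy).
Qed.

(** A singleton is separated; on the empty space the number is 0 and [ln 0 = 0]. *)
Lemma ln_separated_number_ge0 n (eps : R) : 0 < eps ->
  0 <= ln (separated_number f n eps).
Proof.
move=> eps0; have [[x _]|X0] := pselect (exists x : X, True).
  apply: ln_ge0; apply: ub_le_sup; first by have [] := has_sup_separated n eps eps0.
  exists [:: x] => //; split=> // y z.
  by rewrite !inE => /eqP -> /eqP ->; rewrite eqxx.
rewrite ln0//; apply: ge_sup; first by exists 0; exists [::].
by move=> _ [[|x E] _ <-] //; case: X0; exists x.
Qed.

Lemma ln_separated_number_anti n (eps eps' : R) : 0 < eps -> eps <= eps' ->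
  ln (separated_number f n eps') <= ln (separated_number f n eps).
Proof.
move=> eps0 le_eps; have le_sep := separated_number_anti n eps eps' eps0 le_eps.
have [sep0|sep0] := leP (separated_number f n eps') 0.
  by rewrite (ln0 sep0) ln_separated_number_ge0.
by rewrite ler_ln// posrE (lt_le_trans sep0).
Qed.

Lemma topological_entropy_le : (topological_entropy f <= lam%:E)%E.
Proof.
rewrite /topological_entropy; set F := (F in lim (F @ _)).
(* By monotonicity the limit at 0 from the right is a supremum, so each [eps] can be bounded
   separately. *)
have anti : {in `]0, +oo[%R &, {homo F : e e' / e <= e' >-> (e' <= e)%E}}.
  move=> eps eps' + _; rewrite in_itv/= andbT => eps0 le_eps.
  apply: le_limn_esup => n; rewrite lee_fin ler_wpM2l ?invr_ge0//.
  exact: ln_separated_number_anti.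
rewrite (cvg_lim _ (nonincreasing_at_right_cvge +oo%O _ anti))//.
apply: ge_ereal_sup => _ [eps + <-]; rewrite set_itvE => eps0.
apply: limn_esup_le_near => e e0.
have [M EM] := separated_bound eps eps0.
apply: filterS2 (nbhs_infty_gt 0) (near_normr_invnM_le (lam * M%:R) e e0) => n n0.
rewrite ler_norml => /andP[_ nM]; rewrite -EFinD lee_fin.
have lnn : ln (separated_number f n eps) <= lam * (n + M)%:R.
  have [sep0|sep0] := leP (separated_number f n eps) 0.
    by rewrite ln0// mulr_ge0.
  rewrite -ler_expR lnK ?posrE//; apply: ge_sup; first by exists 0; exists [::].
  by move=> _ [E /EM + <-].
(* This quotient is [lam] plus [lam * M / n], and the second term is at most [e] for large [n]. *)
apply: (@le_trans _ _ (n%:R^-1 * (lam * (n + M)%:R))).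
  by rewrite ler_wpM2l ?invr_ge0.
rewrite natrD mulrDr mulrDr lerD// mulrCA mulVf ?mulr1//.
by rewrite pnatr_eq0 -lt0n.
Qed.

End Entropy.

(** * Passage to the dimension and the Lebesgue rate *)

Lemma hausdorff_dim_ge0 (R : realType) (X : metricType R) (A : set X) :
  (0 <= hausdorff_dim A)%E.
Proof. by apply: le_ereal_inf_tmp => _ [s [s0 _] <-]; rewrite lee_fin. Qed.

Lemma topological_entropy_le_mul (R : realType) (X : metricType R) (f : X -> X)
    (s b : R) :
  compact [set: X] -> continuous f ->
  (hausdorff_dim [set: X] < s%:E)%E -> (lebesgue_rate f < b%:E)%E ->
  (topological_entropy f <= (s * b)%:E)%E.
Proof.
move=> cptX cf /ereal_inf_lt[_ [t [t0 Ht] <-]]; rewrite lte_fin => ts fb.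
have s0 : (0 < s)%R := le_lt_trans t0 ts.
have b0 : (0 < b)%R by rewrite -lte_fin (le_lt_trans _ fb)// lebesgue_rate_ge0.
apply: topological_entropy_le; first by rewrite mulr_ge0// ltW.
move=> eps eps0; apply: separated_size_bound => // eta eta0.
exact: (hausdorff_null_cover _ t).
Qed.

Local Open Scope ereal_scope.

(* The product is only claimed to bound the entropy when it is not of the
   indeterminate form 0 * +oo or +oo * 0, which the library evaluates to 0. *)
Theorem corollary4p9 (R : realType) (X : metricType R) (f : X -> X)
    (cptX : compact [set: X]) (cf : continuous f)
    (prod_def : hausdorff_dim [set: X] *? lebesgue_rate f) :
  topological_entropy f <= hausdorff_dim [set: X] * lebesgue_rate f.
Proof.
have := hausdorff_dim_ge0 R X setT; have := lebesgue_rate_ge0 f.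
move: prod_def (fun s b => topological_entropy_le_mul R X f s b cptX cf).
rewrite mule_defE.
case: (hausdorff_dim _) => [D| |]; case: (lebesgue_rate _) => [L| |]//=.
- rewrite !lee_fin => _ le_sb L0 D0; rewrite -EFinM; apply/lee_addgt0Pr => e e0.
  (* Since [t <= 1], the product [(D + t) * (L + t)] exceeds [D * L] by at most [t * (D + L + 1)],
     hence by at most [e]. *)
  pose t : R := (Num.min 1 (e / (D + L + 1)))%R.
  have DL : (0 < D + L + 1)%R by rewrite ltr_wpDl// addr_ge0.
  have t0 : (0 < t)%R by rewrite lt_min ltr01 divr_gt0.
  have t1 : (t <= 1)%R by rewrite ge_min lexx.
  have te : (t * (D + L + 1) <= e)%R by rewrite -ler_pdivlMr// ge_min lexx orbT.
  apply: le_trans (le_sb (D + t)%R (L + t)%R _ _) _; rewrite ?lte_fin ?ltrDl//.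
  rewrite -EFinD lee_fin; nra.
(* With an infinite factor, [prod_def] makes the other one nonzero, hence positive, and the product
   is [+oo]. *)
- rewrite eqxx orbF andbT => D0 _ _; rewrite le_eqVlt eq_sym (negbTE D0) => Dgt0.
  by rewrite gt0_muley// leey.
- rewrite eqxx andbT => L0 _; rewrite le_eqVlt eq_sym (negbTE L0) => Lgt0 _.
  by rewrite gt0_mulye// leey.
- by move=> *; rewrite mulyy leey.
Qed.
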